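(* Let $m\ge 1$ be an integer, $a,b>0$, and let $f(t,y)$ be a real-valued function that is continuous in the rectangle $\mathcal{R}=\{(t,y)\in\mathbb{R}^2 : |t-t_0|\le a,\ |y-y_0|\le b\}$ and Lipschitz in $\mathcal{R}$ with respect to the variable $y$ with constant $K>0$. Let $y(t)$ be the solution of $y'(t)=f(t,y(t))$, $y(t_0)=y_0$, having $m-1$ continuous derivatives at $t=t_0$, and let $T_{m-1}(t_0,t)$ be its Taylor polynomial of degree $m-1$ at $t_0$. Let $h$ with $0<|h|\le a$ be such that $$|T_{m-1}(t_0,t)-y_0|<\frac{b}{3}\quad\text{for all } |t-t_0|\le |h|.$$ If $|f|\le M$ in $\mathcal{R}$, with $M>0$, then, with $I=[y_0-b/3,\,y_0+b/3]$, the Spline-Integral Operator $G_\alpha: I\to I$ (taken with step $\alpha$) has a unique fixed point whenever $\alpha\ne 0$ and $$|\alpha|<\min\left\{|h|,\ \frac{b}{3M},\ \frac{m+1}{K}\right\}.$$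
   Context: The Taylor polynomial is $T_{m-1}(t_0,t)=\sum_{k=0}^{m-1}\frac{1}{k!}\frac{d^k y(t_0)}{dt^k}(t-t_0)^k$. For a step $\alpha\neq 0$ and $w\in\mathbb{R}$, the spline of degree $m$ is $$S_m(t_0,t,w)=T_{m-1}(t_0,t)+s_m(t-t_0)^m,\qquad s_m=\frac{w-T_{m-1}(t_0,t_0+\alpha)}{\alpha^m},$$ so that $S_m(t_0,t_0+\alpha,w)=w$. The Spline-Integral Operator with step $\alpha$ is $$G_\alpha(w)=y_0+\int_{t_0}^{t_0+\alpha} f(t,S_m(t_0,t,w))\,dt,$$ defined when $(t,S_m(t_0,t,w))\in\mathcal{R}$ for all $|t-t_0|\le|\alpha|$. *)

(* Defs.v *)
From Stdlib Require Import Reals Factorial.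
From Coquelicot Require Import Coquelicot.
Local Open Scope R_scope.

Definition rectangle (t0 y0 a b : R) (p : R * R) : Prop :=
  Rabs (fst p - t0) <= a /\ Rabs (snd p - y0) <= b.

Definition lipschitz_snd (D : R * R -> Prop) (f : R * R -> R) (K : R) : Prop :=
  forall t y1 y2 : R, D (t, y1) -> D (t, y2) ->
    Rabs (f (t, y1) - f (t, y2)) <= K * Rabs (y1 - y2).

(* [y] is a total function, but it is only required to satisfy the equation,
   with its graph in the domain [D] of [f], on some open interval around [t0]. *)
Definition is_ivp_solution (D : R * R -> Prop) (f : R * R -> R)
    (t0 y0 : R) (y : R -> R) : Prop :=
  y t0 = y0 /\
  exists delta : R, 0 < delta /\
    forall t : R, Rabs (t - t0) < delta ->
      D (t, y t) /\ is_derive y t (f (t, y t)).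

(* [Derive_n] is total, so continuity of the k-th derivative at [x] is only
   meaningful together with its existence near [x]. *)
Definition has_continuous_derivatives_at (n : nat) (y : R -> R) (x : R) : Prop :=
  forall k : nat, (k <= n)%nat ->
    locally x (fun t => ex_derive_n y k t) /\ continuous (Derive_n y k) x.

(* Degree at most [n]: [sum_n] has the n + 1 terms k = 0, ..., n. *)
Definition taylor (n : nat) (y : R -> R) (t0 t : R) : R :=
  sum_n (fun k => / INR (fact k) * Derive_n y k t0 * (t - t0) ^ k) n.

Definition spline_coef (m : nat) (y : R -> R) (t0 alpha w : R) : R :=
  (w - taylor (m - 1) y t0 (t0 + alpha)) / alpha ^ m.

Definition spline (m : nat) (y : R -> R) (t0 alpha t w : R) : R :=
  taylor (m - 1) y t0 t + spline_coef m y t0 alpha w * (t - t0) ^ m.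

(* [RInt] is oriented, which matters when [alpha < 0]. *)
Definition spline_integral_op (m : nat) (f : R * R -> R) (y : R -> R)
    (t0 y0 alpha w : R) : R :=
  y0 + RInt (fun t => f (t, spline m y t0 alpha t w)) t0 (t0 + alpha).

(* Since [f] and [RInt] are total, the operator is meaningful at [w] only if the
   spline stays in the domain [D] of [f] and the integral exists. *)
Definition spline_integral_op_defined (D : R * R -> Prop) (m : nat)
    (f : R * R -> R) (y : R -> R) (t0 alpha w : R) : Prop :=
  (forall t : R, Rabs (t - t0) <= Rabs alpha ->
     D (t, spline m y t0 alpha t w)) /\
  ex_RInt (fun t => f (t, spline m y t0 alpha t w)) t0 (t0 + alpha).

(* Main.v *)
(** In the variable [u = (t - t0) / alpha] of [[0, 1]] the spline is
    [T + (w - T(t0 + alpha)) u ^ m], so it stays strictly inside the rectangle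
    (distance less than [b/3 + 2 b/3] from [y0]), and two splines with end values
    [v], [w] differ by [(v - w) u ^ m].  Integrating the Lipschitz bound over
    [[0, 1]] shows that [G] is Lipschitz with constant [K |alpha| / (m + 1) < 1];
    it maps [I] to itself because [|alpha| M < b / 3]. *)
Require Import Defs.
From Stdlib Require Import Reals Factorial Lra.
From Coquelicot Require Import Coquelicot.
Local Open Scope R_scope.

(** * Fixed points of contractions of a compact interval *)

Lemma lipschitz_continuous (g : R -> R) (L x : R) :
  (forall u v, Rabs (g u - g v) <= L * Rabs (u - v)) -> continuous g x.
Proof.
  intros HL.
  apply continuity_pt_filterlim.
  intros eps Heps.
  (* The denominator [Rabs L + 1] is positive whatever the sign of [L], and it also covers
     [L = 0]. *)
  exists (eps / (Rabs L + 1)).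
  assert (HL0 := Rabs_pos L).
  split.
  { apply Rdiv_lt_0_compat; lra. }
  intros z [_ Hz]. simpl in *. unfold R_dist in *.
  apply Rle_lt_trans with ((Rabs L + 1) * Rabs (z - x)).
  - apply Rle_trans with (1 := HL z x).
    apply Rmult_le_compat_r; [apply Rabs_pos|].
    assert (HLL := Rle_abs L); lra.
  - replace eps with ((Rabs L + 1) * (eps / (Rabs L + 1))) at 1 by (field; lra).
    apply Rmult_lt_compat_l; lra.
Qed.

(** Existence comes from the intermediate value theorem rather than from Picard iteration: [w - g w]
    is nonpositive at [lo] and nonnegative at [hi]. Uniqueness comes from [L < 1], since two fixed
    points satisfy [|w - v| <= L * |w - v|]. *)
Lemma contraction_interval_fixed_point (g : R -> R) (lo hi L : R) :
  lo <= hi -> 0 <= L < 1 ->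
  (forall w, lo <= w <= hi -> lo <= g w <= hi) ->
  (forall v w, lo <= v <= hi -> lo <= w <= hi ->
     Rabs (g v - g w) <= L * Rabs (v - w)) ->
  exists! w, lo <= w <= hi /\ g w = w.
Proof.
  intros Hlh HL Hmaps Hlip.
  (* Clamping to [lo, hi] gives a total function, as the IVT needs. *)
  set (c := fun w => Rmax lo (Rmin hi w)).
  assert (Hc : forall w, lo <= c w <= hi).
  { intros w; unfold c, Rmax, Rmin; repeat destruct Rle_dec; lra. }
  assert (Hcid : forall w, lo <= w <= hi -> c w = w).
  { intros w; unfold c, Rmax, Rmin; repeat destruct Rle_dec; lra. }
  assert (Hclip : forall v w, Rabs (c v - c w) <= Rabs (v - w)).
  { intros v w; unfold c, Rmax, Rmin, Rabs;
    repeat destruct Rle_dec; repeat destruct Rcase_abs; lra. }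
  assert (Hcont : continuity (fun w => w - g (c w))).
  { intros x. apply continuity_pt_filterlim.
    apply (continuous_minus (fun w => w) (fun w => g (c w))).
    - apply continuous_id.
    - apply (lipschitz_continuous _ L). intros u v.
      apply Rle_trans with (1 := Hlip _ _ (Hc u) (Hc v)).
      apply Rmult_le_compat_l; [lra | apply Hclip]. }
  destruct (IVT_gen (fun w => w - g (c w)) lo hi 0 Hcont) as [w [Hw Hw0]].
  { rewrite (Hcid lo), (Hcid hi) by lra.
    assert (Hglo := Hmaps lo). assert (Hghi := Hmaps hi).
    unfold Rmin, Rmax; repeat destruct Rle_dec; lra. }
  rewrite Rmin_left, Rmax_right in Hw by lra.
  rewrite (Hcid w Hw) in Hw0.
  exists w. split; [split; [exact Hw | lra]|].
  intros v [Hv Hgv].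
  assert (Hd := Hlip w v Hw Hv).
  rewrite Hgv in Hd. replace (g w) with w in Hd by lra.
  destruct (Req_dec w v) as [|Hne]; [assumption|].
  assert (0 < Rabs (w - v)) by (apply Rabs_pos_lt; lra).
  nra.
Qed.

(** * Continuity of the spline, and of [f] inside the rectangle *)

Lemma continuous_taylor (n : nat) (y : R -> R) (t0 t : R) :
  continuous (taylor n y t0) t.
Proof.
  unfold taylor.
  induction n as [|n IH].
  - apply continuous_ext with
      (fun t => / INR (fact 0) * Derive_n y 0 t0 * (t - t0) ^ 0).
    { intros x; now rewrite sum_O. }
    simpl. apply continuous_const.
  - eapply continuous_ext.
    { intros x; symmetry; apply sum_Sn. }
    apply (continuous_plus (V := R_NormedModule)); [exact IH|].
    apply ex_derive_continuous. auto_derive. exact Logic.I.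
Qed.

Lemma continuous_spline (m : nat) (y : R -> R) (t0 alpha w t : R) :
  continuous (fun t => spline m y t0 alpha t w) t.
Proof.
  apply (continuous_plus (V := R_NormedModule)).
  - apply continuous_taylor.
  - apply ex_derive_continuous. auto_derive. exact Logic.I.
Qed.

Lemma rectangle_interior (t0 y0 a b t z : R) :
  Rabs (t - t0) < a -> Rabs (z - y0) < b ->
  locally (t, z) (rectangle t0 y0 a b).
Proof.
  intros Ht Hz.
  assert (He : 0 < Rmin (a - Rabs (t - t0)) (b - Rabs (z - y0))).
  { apply Rmin_case; lra. }
  exists (mkposreal _ He).
  intros [t' z'] [Ht' Hz'].
  unfold ball in Ht', Hz'; simpl in Ht', Hz'.
  unfold AbsRing_ball, abs, minus, plus, opp in Ht', Hz'; simpl in Ht', Hz'.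
  assert (H1 := Rmin_l (a - Rabs (t - t0)) (b - Rabs (z - y0))).
  assert (H2 := Rmin_r (a - Rabs (t - t0)) (b - Rabs (z - y0))).
  split; simpl.
  - assert (H3 := Rabs_triang (t' + - t) (t - t0)).
    replace (t' + - t + (t - t0)) with (t' - t0) in H3 by ring. lra.
  - assert (H3 := Rabs_triang (z' + - z) (z - y0)).
    replace (z' + - z + (z - y0)) with (z' - y0) in H3 by ring. lra.
Qed.

(** [continuous_on D] only controls limits taken within [D]; a neighbourhood of [x] contained in [D]
    makes that restriction harmless. The integrability criterion used below asks for unrestricted
    continuity of the integrand, endpoints included, whereas [f] is arbitrary outside the
    rectangle. *)
Lemma continuous_on_interior {U V : UniformSpace} (D : U -> Prop) (f : U -> V)
    (x : U) :
  continuous_on D f -> locally x D -> continuous f x.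
Proof.
  intros Hf HD P HP.
  generalize (filter_and _ _ HD (Hf x (locally_singleton _ _ HD) P HP)).
  unfold filtermap, within.
  apply filter_imp. intros z [Hz HPz]. now apply HPz.
Qed.

(** * Change of variable to the unit interval *)

Lemma is_RInt_pow_0_1 (m : nat) :
  is_RInt (fun u => u ^ m) 0 1 (/ (INR m + 1)).
Proof.
  assert (Hm := pos_INR m).
  replace (/ (INR m + 1)) with
    (minus (1 ^ S m / (INR m + 1)) (0 ^ S m / (INR m + 1))).
  2: { change (1 ^ S m / (INR m + 1) - 0 ^ S m / (INR m + 1) = / (INR m + 1)).
       rewrite pow1, pow_i by apply PeanoNat.Nat.lt_0_succ. field. lra. }
  apply (is_RInt_derive (fun u => u ^ S m / (INR m + 1))).
  - intros u _. auto_derive; [exact Logic.I|].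
    change (1 * (INR (S m) * u ^ m) * / (INR m + 1) = u ^ m).
    rewrite S_INR. field. lra.
  - intros u _. apply (ex_derive_continuous (V := R_NormedModule)). auto_derive. exact Logic.I.
Qed.

(** The [alpha ^ m] in the denominator of [spline_coef] cancels against [(alpha * u) ^ m]. *)
Lemma spline_rescaled (m : nat) (y : R -> R) (t0 alpha w u : R) :
  alpha <> 0 ->
  spline m y t0 alpha (alpha * u + t0) w =
  taylor (m - 1) y t0 (alpha * u + t0)
  + (w - taylor (m - 1) y t0 (t0 + alpha)) * u ^ m.
Proof.
  intros Ha. unfold spline, spline_coef.
  replace (alpha * u + t0 - t0) with (alpha * u) by ring.
  rewrite Rpow_mult_distr. field. now apply pow_nonzero.
Qed.

(** The sign of [alpha] moves from the orientation of the interval into the integrand, so that norm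
    estimates, which need ordered endpoints, treat both signs at once. *)
Lemma is_RInt_rescaled (g : R -> R) (t0 alpha l : R) :
  is_RInt g t0 (t0 + alpha) l ->
  is_RInt (fun u => alpha * g (alpha * u + t0)) 0 1 l.
Proof.
  intros H. apply (is_RInt_comp_lin g alpha t0 0 1).
  replace (alpha * 0 + t0) with t0 by ring.
  now replace (alpha * 1 + t0) with (t0 + alpha) by ring.
Qed.

(** * Self-map and contraction estimates for the operator *)

Theorem theorem2p2 (m : nat) (hm : (1 <= m)%nat)
  (t0 y0 a b : R) (ha : 0 < a) (hb : 0 < b)
  (f : R * R -> R)
  (hf : continuous_on (rectangle t0 y0 a b) f)
  (K : R) (hK : 0 < K)
  (hLip : lipschitz_snd (rectangle t0 y0 a b) f K)
  (y : R -> R)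
  (hsol : is_ivp_solution (rectangle t0 y0 a b) f t0 y0 y)
  (hy : has_continuous_derivatives_at (m - 1) y t0)
  (h : R) (hh : 0 < Rabs h <= a)
  (hT : forall t : R, Rabs (t - t0) <= Rabs h ->
          Rabs (taylor (m - 1) y t0 t - y0) < b / 3)
  (M : R) (hM : 0 < M)
  (hfM : forall p : R * R, rectangle t0 y0 a b p -> Rabs (f p) <= M)
  (alpha : R) (halpha0 : alpha <> 0)
  (halpha : Rabs alpha < Rmin (Rabs h) (Rmin (b / (3 * M)) ((INR m + 1) / K))) :
  let I := fun w : R => y0 - b / 3 <= w <= y0 + b / 3 in
  let G := spline_integral_op m f y t0 y0 alpha in
  (forall w : R, I w ->
     spline_integral_op_defined (rectangle t0 y0 a b) m f y t0 alpha w /\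
     I (G w)) /\
  (exists! w : R, I w /\ G w = w).
Proof.
  intros I G.
  (* The three bounds serve in turn to keep [t] in the range of [hT] and of the rectangle, to map
     [I] into itself, and to make the Lipschitz constant of [G] less than 1. *)
  assert (Hal : Rabs alpha < Rabs h /\ Rabs alpha * M < b / 3
                /\ Rabs alpha * K < INR m + 1).
  { apply Rmin_Rgt in halpha as [H1 H2]. apply Rmin_Rgt in H2 as [H2 H3].
    split; [exact H1|]. split.
    - apply Rmult_lt_compat_r with (r := M) in H2; [|exact hM].
      replace (b / (3 * M) * M) with (b / 3) in H2 by (field; lra). exact H2.
    - apply Rmult_lt_compat_r with (r := K) in H3; [|exact hK].
      replace ((INR m + 1) / K * K) with (INR m + 1) in H3 by (field; lra).
      exact H3. }
  destruct Hal as (Hah & HaM & HaK).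
  assert (Hm := pos_INR m).
  assert (Hapos : 0 < Rabs alpha) by now apply Rabs_pos_lt.
  assert (Hresc : forall u, 0 <= u <= 1 -> Rabs (alpha * u + t0 - t0) <= Rabs alpha).
  { intros u Hu. replace (alpha * u + t0 - t0) with (alpha * u) by ring.
    rewrite Rabs_mult, (Rabs_pos_eq u) by lra. nra. }
  (* Strict inequalities are proved although the rectangle is closed: they place the graph of the
     spline in its interior, where [f] is continuous in the full sense. *)
  assert (Hin : forall w t, I w -> Rabs (t - t0) <= Rabs alpha ->
            Rabs (t - t0) < a /\ Rabs (spline m y t0 alpha t w - y0) < b).
  { intros w t Hw Ht. split; [lra|].
    unfold spline, spline_coef.
    assert (HTt := hT t ltac:(lra)).
    assert (HTa := hT (t0 + alpha)
                     ltac:(replace (t0 + alpha - t0) with alpha by ring; lra)).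
    set (T := taylor (m - 1) y t0 t) in *.
    set (A := taylor (m - 1) y t0 (t0 + alpha)) in *.
    replace (T + (w - A) / alpha ^ m * (t - t0) ^ m - y0)
      with ((T - y0) + (w - A) * ((t - t0) / alpha) ^ m).
    2: { unfold Rdiv. rewrite Rpow_mult_distr, pow_inv. ring. }
    apply Rle_lt_trans with (1 := Rabs_triang _ _).
    assert (Hpow : Rabs (((t - t0) / alpha) ^ m) <= 1).
    { rewrite <- RPow_abs, <- (pow1 m). apply pow_incr.
      split; [apply Rabs_pos|].
      rewrite Rabs_div by assumption.
      apply Rmult_le_reg_r with (Rabs alpha); [assumption|].
      replace (Rabs (t - t0) / Rabs alpha * Rabs alpha) with (Rabs (t - t0))
        by (field; lra). lra. }
    (* Both [w] and [A] lie within [b / 3] of [y0]. *)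
    assert (HwA : Rabs (w - A) <= b / 3 + b / 3).
    { unfold I in Hw. apply Rabs_def2 in HTa. apply Rabs_le. lra. }
    rewrite Rabs_mult.
    assert (Hp := Rabs_pos (w - A)).
    assert (Hq := Rabs_pos (((t - t0) / alpha) ^ m)).
    nra. }
  assert (HD : forall w t, I w -> Rabs (t - t0) <= Rabs alpha ->
            rectangle t0 y0 a b (t, spline m y t0 alpha t w)).
  { intros w t Hw Ht. destruct (Hin w t Hw Ht).
    split; apply Rlt_le; assumption. }
  assert (Hex : forall w, I w ->
            ex_RInt (fun t => f (t, spline m y t0 alpha t w)) t0 (t0 + alpha)).
  { intros w Hw. apply (ex_RInt_continuous (V := R_CompleteNormedModule)).
    intros t Ht.
    (* The endpoints [t0] and [t0 + alpha] may come in either order, hence the case analysis. *)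
    assert (Ht' : Rabs (t - t0) <= Rabs alpha).
    { revert Ht. unfold Rmin, Rmax, Rabs.
      repeat destruct Rle_dec; repeat destruct Rcase_abs; lra. }
    destruct (Hin w t Hw Ht') as [H1 H2].
    apply (continuous_comp_2 (fun t => t) (fun t => spline m y t0 alpha t w)
             (fun t z => f (t, z))).
    - apply continuous_id.
    - apply continuous_spline.
    - apply continuous_ext with f.
      { intros [? ?]; reflexivity. }
      apply (continuous_on_interior _ _ _ hf).
      now apply rectangle_interior. }
  set (F := fun w u =>
    alpha * f (alpha * u + t0, spline m y t0 alpha (alpha * u + t0) w)).
  assert (HF : forall w, I w -> ex_RInt (F w) 0 1).
  { intros w Hw. destruct (Hex w Hw) as [l Hl].
    exists l. exact (is_RInt_rescaled _ _ _ _ Hl). }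
  assert (HG : forall w, I w -> G w = y0 + RInt (F w) 0 1).
  { intros w Hw. unfold G, spline_integral_op. f_equal.
    symmetry. apply is_RInt_unique.
    exact (is_RInt_rescaled _ _ _ _ (RInt_correct _ _ _ (Hex w Hw))). }
  assert (HI : forall w, I w -> I (G w)).
  { intros w Hw. rewrite (HG w Hw).
    (* This bounds [|G w - y0|] by [|alpha| * M], which [HaM] puts below [b / 3]. *)
    assert (Hb : Rabs (RInt (F w) 0 1) <= (1 - 0) * (Rabs alpha * M)).
    { apply abs_RInt_le_const; [lra | now apply HF |].
      intros u Hu. unfold F. rewrite Rabs_mult.
      apply Rmult_le_compat_l; [lra|].
      apply hfM, HD; [exact Hw | now apply Hresc]. }
    apply Rabs_le_between in Hb. unfold I. lra. }
  assert (Hlip : forall v w, I v -> I w ->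
            Rabs (G v - G w) <= Rabs alpha * K / (INR m + 1) * Rabs (v - w)).
  { intros v w Hv Hw. rewrite (HG v Hv), (HG w Hw).
    replace (y0 + RInt (F v) 0 1 - (y0 + RInt (F w) 0 1))
      with (minus (RInt (F v) 0 1) (RInt (F w) 0 1))
      by (unfold minus, plus, opp; simpl; ring).
    rewrite <- RInt_minus by now apply HF.
    (* The target is rewritten as the integral of [|alpha| * K * |v - w| * u ^ m] over the unit
       interval, so that it remains to compare integrands pointwise. *)
    replace (Rabs alpha * K / (INR m + 1) * Rabs (v - w))
      with (scal (Rabs alpha * K * Rabs (v - w)) (/ (INR m + 1)))
      by (unfold scal; simpl; unfold mult; simpl; field; lra).
    apply (norm_RInt_le (V := R_NormedModule) (fun u => minus (F v u) (F w u))
             (fun u => scal (Rabs alpha * K * Rabs (v - w)) (u ^ m)) 0 1).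
    - lra.
    - intros u Hu. unfold F.
      set (t := alpha * u + t0).
      change (Rabs (alpha * f (t, spline m y t0 alpha t v)
                    + - (alpha * f (t, spline m y t0 alpha t w)))
              <= Rabs alpha * K * Rabs (v - w) * u ^ m).
      replace (alpha * f (t, spline m y t0 alpha t v)
               + - (alpha * f (t, spline m y t0 alpha t w)))
        with (alpha * (f (t, spline m y t0 alpha t v)
                       - f (t, spline m y t0 alpha t w))) by ring.
      rewrite Rabs_mult, !Rmult_assoc.
      apply Rmult_le_compat_l; [lra|].
      eapply Rle_trans.
      { apply hLip; apply HD; try assumption; now apply Hresc. }
      apply Rmult_le_compat_l; [lra|].
      (* The Taylor terms cancel in the difference of the two splines. *)
      unfold t. rewrite !spline_rescaled by assumption.
      match goal with |- Rabs ?e <= _ =>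
        replace e with ((v - w) * u ^ m) by ring end.
      rewrite Rabs_mult, (Rabs_pos_eq (u ^ m)); [lra | apply pow_le; lra].
    - apply (RInt_correct (V := R_CompleteNormedModule)).
      apply (ex_RInt_minus (V := R_NormedModule)); now apply HF.
    (* The integral of [u ^ m] is the source of the factor [m + 1] in the admissible step size. *)
    - apply (is_RInt_scal (V := R_NormedModule)), is_RInt_pow_0_1. }
  split.
  - intros w Hw. split; [split|].
    + intros t Ht. now apply HD.
    + now apply Hex.
    + now apply HI.
  - apply contraction_interval_fixed_point
      with (L := Rabs alpha * K / (INR m + 1)); try assumption.
    + lra.
    + split.
      * apply Rlt_le, Rdiv_lt_0_compat; nra.
      * apply Rmult_lt_reg_r with (INR m + 1); [lra|].
        unfold Rdiv. rewrite Rmult_assoc, Rinv_l; lra.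
Qed.
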